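(* Let $d,s,n\in\mathbb{N}$, let $A\in\mathbb{R}^{d\times d}$, and consider the linear initial value problem $\dot{x}(t)=Ax$, $x(t_0)=x_0$, with $t_0\in\mathbb{R}$. Let $\gamma$ be a path in $\mathbb{C}$ with $\gamma(0)=t_0$ such that the time grid $\Delta_n^\gamma=[t_0,t_1,\dots,t_n]$, $t_j:=\gamma(j/n)$, is symmetric and satisfies $t_n\in\mathbb{R}$. Let $x_n:=x_{\Delta_n^\gamma}(t_n)$ be the value at the terminal point constructed by applying to this problem, along $\Delta_n^\gamma$ and starting from $x_0$, an $s$-stage explicit Runge-Kutta method with real coefficients $\mathfrak{A}\in\mathbb{R}^{s\times s}$ and $\mathfrak{b},\mathfrak{c}\in\mathbb{R}^s$. Then $$x_0\in\mathbb{R}^d\quad\Rightarrow\quad x_n\in\mathbb{R}^d.$$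
   Context: A time grid is an indexed (ordered) set $\Delta=[t_0,\dots,t_n]\subset\mathbb{C}$ with (complex) time steps $\tau_j:=t_{j+1}-t_j$, $j\in\{0,\dots,n-1\}$. It is called symmetric if there is a permutation $\pi\in\mathcal{S}_n$ of $\{1,\dots,n\}$ with $\pi^2=\mathrm{id}$ such that $\tau_j=\overline{\tau_{\pi(j+1)-1}}$ for all $j\in\{0,\dots,n-1\}$ (bar denotes complex conjugation). An $s$-stage explicit Runge-Kutta method with coefficients $\mathfrak{A}$ (strictly lower triangular), $\mathfrak{b}$, $\mathfrak{c}$ applied to $\dot{x}=Ax$ has the one-step map (discrete evolution) $\Psi^{t+\tau,t}x=x+\tau\sum_{i=1}^s\mathfrak{b}_ik_i$ with $k_i=Ax+\tau\sum_{j=1}^{i-1}\mathfrak{A}_{i,j}Ak_j$, for $\tau\in\mathbb{C}$. The grid function is $x_\Delta(t_0)=x_0$, $x_\Delta(t_{j+1})=\Psi^{t_{j+1},t_j}x_\Delta(t_j)$, defined recursively along the index $j$. *)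

(* Defs.v *)
From HB Require Import structures.
From mathcomp Require Import all_boot all_order all_algebra all_fingroup.
From mathcomp Require Import complex.
From mathcomp Require Import all_classical all_reals topology normedtype.

Set Implicit Arguments.
Unset Strict Implicit.
Unset Printing Implicit Defensive.

Import Order.TTheory GRing.Theory Num.Theory numFieldNormedType.Exports.

Local Open Scope classical_set_scope.
Local Open Scope ring_scope.

Definition time_step (C : numClosedFieldType) (Delta : seq C) (j : nat) : C :=
  Delta`_j.+1 - Delta`_j.

(* The index j : 'I_n stands for j + 1 in {1, ..., n}, so that the condition
   tau_j = conj (tau_(pi (j + 1) - 1)) carries no index shift. *)
Definition symmetric_grid (C : numClosedFieldType) (n : nat)
    (Delta : n.+1.-tuple C) : Prop :=
  exists pi : 'S_n, (pi * pi = 1)%g /\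
    forall j : 'I_n, time_step Delta j = (time_step Delta (pi j))^*.

Definition path_grid (R : realType) (gamma : R -> R[i]) (n : nat) :
    n.+1.-tuple R[i] :=
  [tuple gamma ((j : nat)%:R / n%:R) | j < n.+1].

(* R[i]^o carries the topology given by the complex modulus. *)
Definition is_path (R : realType) (gamma : R -> R[i]) : Prop :=
  {within `[0, 1], continuous (gamma : R -> R[i]^o)}.

(* The nodes play no role below: the right-hand side A x is autonomous. *)
Record explicit_rk (C : numClosedFieldType) (s : nat) := ExplicitRK {
  rk_matrix : 'M[C]_s;
  rk_weights : 'cV[C]_s;
  rk_nodes : 'cV[C]_s;
  rk_matrix_strict : forall i j : 'I_s, (i <= j)%N -> rk_matrix i j = 0
}.

Section RungeKutta.
Variables (C : numClosedFieldType) (d s : nat).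
Variables (M : explicit_rk C s) (A : 'M[C]_d).

(* Structural recursion on fuel m; any m > i gives the value of the i-th
   stage, see [rk_stageE]. *)
Fixpoint rk_stage_rec (tau : C) (x : 'cV[C]_d) (m : nat) (i : 'I_s) :
    'cV[C]_d :=
  if m is m'.+1 then
    A *m x + tau *: \sum_(j < s | (j < i)%N)
      rk_matrix M i j *: (A *m rk_stage_rec tau x m' j)
  else 0.

Definition rk_stage (tau : C) (x : 'cV[C]_d) (i : 'I_s) : 'cV[C]_d :=
  rk_stage_rec tau x i.+1 i.

Lemma rk_stage_rec_fuel tau x m m' (i : 'I_s) : (i < m)%N -> (i < m')%N ->
  rk_stage_rec tau x m i = rk_stage_rec tau x m' i.
Proof.
elim: m m' i => [|m IH] [|m'] i //= im im'.
congr (_ + _ *: _); apply: eq_bigr => j ji.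
by rewrite (IH m') ?(leq_trans ji).
Qed.

Lemma rk_stageE tau x (i : 'I_s) :
  rk_stage tau x i = A *m x + tau *: \sum_(j < s | (j < i)%N)
    rk_matrix M i j *: (A *m rk_stage tau x j).
Proof.
rewrite {1}/rk_stage /=; congr (_ + _ *: _); apply: eq_bigr => j ji.
by rewrite (@rk_stage_rec_fuel tau x i j.+1).
Qed.

(* Psi^(t', t) x, with tau = t' - t *)
Definition rk_evolution (t' t : C) (x : 'cV[C]_d) : 'cV[C]_d :=
  x + (t' - t) *: \sum_(i < s) rk_weights M i 0 *: rk_stage (t' - t) x i.

(* Indexed by j rather than by the point t_j, since grid points may coincide. *)
Fixpoint grid_function (Delta : seq C) (x0 : 'cV[C]_d) (j : nat) : 'cV[C]_d :=
  if j is j'.+1 then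
    rk_evolution Delta`_j'.+1 Delta`_j' (grid_function Delta x0 j')
  else x0.

End RungeKutta.

(* Main.v *)
Require Import Defs.
From mathcomp Require Import all_boot all_order all_algebra all_fingroup.
From mathcomp Require Import complex.
From mathcomp Require Import all_classical all_reals topology normedtype.
Import Order.TTheory GRing.Theory Num.Theory numFieldNormedType.Exports.
Local Open Scope ring_scope.

(** On x' = A x a Runge-Kutta step of size tau multiplies the state by q_tau(A),
    where q_tau(z) = S(tau z) and S is the stability polynomial of the method
    (lemma [rk_evolution_horner]).  Hence the terminal value is Q(A) x0 where Q
    is the product of the q_(tau_j) over all steps ([grid_function_horner]).
    Since the method has real coefficients, conjugating the coefficients of
    q_tau gives q_(conj tau) ([conj_step_poly]).  On a symmetric grid,
    conjugation therefore only permutes the factors of Q; polynomials commute,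
    so Q is its own conjugate ([conj_prod_step_poly]) and has real coefficients.
    So Q(A) x0 is real as soon as A and x0 are. *)

Section StabilityPolynomial.
Variables (C : numClosedFieldType) (s : nat) (M : explicit_rk C s).

(** For m > i, the i-th stage is k_i = A p(A) x with p = [stage_poly tau m i].
    The recursion follows that of [rk_stage_rec], so that the two agree for
    every fuel m. *)
Fixpoint stage_poly (tau : C) (m : nat) (i : 'I_s) : {poly C} :=
  if m is m'.+1 then
    1 + tau *: ('X * \sum_(j < s | (j < i)%N)
                       rk_matrix M i j *: stage_poly tau m' j)
  else 0.

Definition step_poly (tau : C) : {poly C} :=
  1 + tau *: ('X * \sum_(i < s) rk_weights M i 0 *: stage_poly tau i.+1 i).

Section Evolution.
Variables (d : nat) (A : 'M[C]_d.+1).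

Lemma rk_stage_rec_horner tau x m i :
  rk_stage_rec M A tau x m i = A *m (horner_mx A (stage_poly tau m i) *m x).
Proof.
elim: m i => [|m IHm] i /=; first by rewrite rmorph0 mul0mx mulmx0.
rewrite rmorphD rmorph1 /= horner_mxZ rmorphM /= horner_mx_X.
rewrite mulmxDl mul1mx mulmxDr.
congr (_ + _); rewrite -scalemxAl -scalemxAr -mulmxA; congr (_ *: _).
rewrite rmorph_sum mulmx_suml !mulmx_sumr; apply: eq_bigr => j _.
by rewrite IHm /= horner_mxZ -scalemxAl -!scalemxAr.
Qed.

Lemma rk_evolution_horner t' t x :
  rk_evolution M A t' t x = horner_mx A (step_poly (t' - t)) *m x.
Proof.
rewrite /rk_evolution /step_poly rmorphD rmorph1 /=.
rewrite horner_mxZ rmorphM /= horner_mx_X.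
rewrite mulmxDl mul1mx; congr (_ + _); rewrite -scalemxAl -mulmxA.
congr (_ *: _); rewrite rmorph_sum mulmx_suml mulmx_sumr.
apply: eq_bigr => i _; rewrite /rk_stage rk_stage_rec_horner.
by rewrite /= horner_mxZ -scalemxAl -scalemxAr.
Qed.

Lemma grid_function_horner (Delta : seq C) x0 n :
  grid_function M A Delta x0 n =
    horner_mx A (\prod_(j < n) step_poly (time_step Delta j)) *m x0.
Proof.
elim: n => [|n IHn] /=; first by rewrite big_ord0 rmorph1 mul1mx.
by rewrite rk_evolution_horner IHn mulmxA big_ord_recr /= mulrC rmorphM.
Qed.

End Evolution.

Hypothesis rk_matrix_real : rk_matrix M \is a mxOver Num.real.
Hypothesis rk_weights_real : rk_weights M \is a mxOver Num.real.

Lemma conj_stage_poly tau m i :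
  map_poly Num.conj (stage_poly tau m i) = stage_poly tau^* m i.
Proof.
elim: m i => [|m IHm] i /=; first by rewrite rmorph0.
rewrite rmorphD rmorph1 /= map_polyZ rmorphM /= map_polyX rmorph_sum.
congr (_ + _ *: (_ * _)); apply: eq_bigr => j _.
rewrite /= map_polyZ IHm; congr (_ *: _).
exact/CrealP/(mxOverP rk_matrix_real).
Qed.

Lemma conj_step_poly tau :
  map_poly Num.conj (step_poly tau) = step_poly tau^*.
Proof.
rewrite rmorphD rmorph1 /= map_polyZ rmorphM /= map_polyX rmorph_sum.
congr (_ + _ *: (_ * _)); apply: eq_bigr => i _.
rewrite [LHS]map_polyZ; congr (_ *: _); last exact: (conj_stage_poly tau i.+1).
exact/CrealP/(mxOverP rk_weights_real).
Qed.

Lemma conj_prod_step_poly n (Delta : n.+1.-tuple C) : symmetric_grid Delta ->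
  map_poly Num.conj (\prod_(j < n) step_poly (time_step Delta j)) =
    \prod_(j < n) step_poly (time_step Delta j).
Proof.
case=> pi [_ symDelta].
rewrite rmorph_prod (reindex_inj (@perm_inj _ pi)); apply: eq_bigr => j _.
by rewrite /= conj_step_poly -symDelta.
Qed.

End StabilityPolynomial.

Lemma mxOver_realP (C : numClosedFieldType) m n (B : 'M[C]_(m, n)) :
  reflect (map_mx Num.conj B = B) (B \is a mxOver Num.real).
Proof.
apply: (iffP mxOverP) => [realB | conjB i j].
  by apply/matrixP => i j; rewrite mxE; apply/CrealP.
by apply/CrealP; rewrite -[in RHS]conjB mxE.
Qed.

Lemma grid_function_real (C : numClosedFieldType) d s n (M : explicit_rk C s)
    (A : 'M[C]_d) (Delta : n.+1.-tuple C) (x0 : 'cV[C]_d) :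
    rk_matrix M \is a mxOver Num.real -> rk_weights M \is a mxOver Num.real ->
    symmetric_grid Delta ->
    A \is a mxOver Num.real -> x0 \is a mxOver Num.real ->
  grid_function M A Delta x0 n \is a mxOver Num.real.
Proof.
(* [horner_mx] needs a positive dimension; a vector of dimension 0 has no entries. *)
case: d A x0 => [|d] A x0 realM realb symDelta realA realx0.
  by apply/mxOverP => - [].
move/mxOver_realP: realA => conjA; move/mxOver_realP: realx0 => conjx0.
apply/mxOver_realP; rewrite grid_function_horner map_mxM map_horner_mx.
by rewrite conj_prod_step_poly // conjA conjx0.
Qed.

Theorem theorem4p1 (R : realType) (d s n : nat) (hn : (0 < n)%N)
    (A : 'M[R[i]]_d) (hA : A \is a mxOver Num.real)
    (t0 : R[i]) (ht0 : t0 \is Num.real)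
    (x0 : 'cV[R[i]]_d)
    (gamma : R -> R[i]) (hgamma : is_path gamma) (hgamma0 : gamma 0 = t0)
    (hsym : symmetric_grid (path_grid gamma n))
    (htn : (path_grid gamma n)`_n \is Num.real)
    (M : explicit_rk R[i] s)
    (hMA : rk_matrix M \is a mxOver Num.real)
    (hMb : rk_weights M \is a mxOver Num.real)
    (hMc : rk_nodes M \is a mxOver Num.real) :
  x0 \is a mxOver Num.real ->
  grid_function M A (path_grid gamma n) x0 n \is a mxOver Num.real.
Proof.
exact: (@grid_function_real R[i] d s n M A (path_grid gamma n) x0 hMA hMb hsym hA).
Qed.
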